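(* ${DL}(\partial)$ is strictly less expressive than ${DL}(\partial_{||})$ when there are no additions. More specifically: (a) for every propositional defeasible theory $D_1$ there is a propositional defeasible theory $D_2$ such that $D_2$ in ${DL}(\partial_{||})$ simulates $D_1$ in ${DL}(\partial)$; and (b) there is a propositional defeasible theory $D$ such that no propositional defeasible theory $D'$ in ${DL}(\partial)$ simulates $D$ in ${DL}(\partial_{||})$.
   Context: Literals are propositions or their negations; ${\sim}q$ is the complement of $q$. A propositional defeasible theory is $D=(F,R,>)$: $F$ finite set of literals, $R$ finite set of rules, $>$ acyclic binary relation on $R$. Each rule has a finite antecedent set $A(r)$ and consequent literal and is strict ($\rightarrow$), defeasible ($\Rightarrow$) or a defeater ($\leadsto$). $R_s$: strict rules; $R_{sd}$: strict and defeasible rules; $R[q]$: rules with consequent $q$. A proof $P$ is a sequence of tagged literals, $P(1..i)$ its first $i$ elements; a conclusion is a consequence if it occurs in some proof. $\Sigma(D)$ is the set of propositions occurring in $D$. $+\Delta$: append $+\Delta q$ if $q\in F$ or some $r\in R_s[q]$ has $+\Delta a\in P(1..i)$ for all $a\in A(r)$. $-\Delta$: append $-\Delta q$ if $q\notin F$ and every $r\in R_s[q]$ has some $a\in A(r)$ with $-\Delta a\in P(1..i)$. ${DL}(\partial)$: tags $\Delta,\partial$. $+\partial$: append $+\partial q$ if (1) $+\Delta q\in P(1..i)$, or (2.1) some $r\in R_{sd}[q]$ has $+\partial a\in P(1..i)$ for all $a\in A(r)$, (2.2) $-\Delta{\sim}q\in P(1..i)$, (2.3) every $s\in R[{\sim}q]$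 has some $a\in A(s)$ with $-\partial a\in P(1..i)$, or some $t\in R_{sd}[q]$ with $t>s$ has $+\partial a\in P(1..i)$ for all $a\in A(t)$. $-\partial$: append $-\partial q$ if $-\Delta q\in P(1..i)$ and either every $r\in R_{sd}[q]$ has some $a\in A(r)$ with $-\partial a\in P(1..i)$, or $+\Delta{\sim}q\in P(1..i)$, or some $s\in R[{\sim}q]$ has $+\partial a\in P(1..i)$ for all $a\in A(s)$ and every $t\in R_{sd}[q]$ either has some $a\in A(t)$ with $-\partial a\in P(1..i)$ or not $t>s$. ${DL}(\partial_{||})$: tags $\Delta,\lambda,\partial_{||}$. $P_\Delta$: all $\pm\Delta$ conclusions derivable. $+\lambda$: append $+\lambda q$ if (1) $+\Delta q\in P_\Delta$, or (2.1) some $r\in R_{sd}[q]$ has $+\lambda a\in P(1..i)$ for all $a\in A(r)$ and (2.2) $+\Delta{\sim}q\notin P_\Delta$. $-\lambda$: append $-\lambda q$ if $-\Delta q\in P_\Delta$ and either every $r\in R_{sd}[q]$ has some $a\in A(r)$ with $-\lambda a\in P(1..i)$, or $+\Delta{\sim}q\in P_\Delta$. $P_\lambda$: all $\pm\lambda$ conclusions derivable. $+\partial_{||}$: append $+\partial_{||}q$ if (1) $+\Delta q\in P_\Delta$, or (2.1) some $r\in R_{sd}[q]$ has $+\partial_{||}a\in P(1..i)$ for all $a\in A(r)$, (2.2) $+\Delta{\sim}q\notin P_\Delta$, (2.3) every $s\in R[{\sim}q]$ has some $a\in A(s)$ with $+\lambda a\notin P_\lambda$, or some $t\in R_{sd}[q]$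 with $t>s$ has $+\partial_{||}a\in P(1..i)$ for all $a\in A(t)$. $-\partial_{||}$: append $-\partial_{||}q$ if $-\Delta q\in P_\Delta$ and either every $r\in R_{sd}[q]$ has some $a\in A(r)$ with $-\partial_{||}a\in P(1..i)$, or $+\Delta{\sim}q\in P_\Delta$, or some $s\in R[{\sim}q]$ has $+\lambda a\in P_\lambda$ for all $a\in A(s)$ and every $t\in R_{sd}[q]$ either has some $a\in A(t)$ with $-\partial_{||}a\in P(1..i)$ or not $t>s$. Simulation (no additions): $D_1$ in logic $L_1$ is simulated by $D_2$ in logic $L_2$ if $D_1$ and $D_2$ have the same consequences on literals over $\Sigma(D_1)$ modulo tags, i.e. for every literal $q$ over $\Sigma(D_1)$ and every sign $\pm$: $\pm\Delta q$ is a consequence of $D_1$ iff it is one of $D_2$, and $\pm d_1 q$ is a consequence of $D_1$ iff $\pm d_2 q$ is one of $D_2$, where the main tag is $d=\partial$ in ${DL}(\partial)$ and $d=\partial_{||}$ in ${DL}(\partial_{||})$. ''Strictly less expressive'' means (a) and (b). *)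

(* Defs.v *)
From HB Require Import structures.
From mathcomp Require Import all_boot.

Set Implicit Arguments.
Unset Strict Implicit.
Unset Printing Implicit Defensive.

(* (p, true) is the proposition p, (p, false) its negation. *)
Notation literal atom := (atom * bool)%type.

Definition compl (atom : Type) (q : literal atom) : literal atom :=
  (q.1, ~~ q.2).

Variant rule_kind := Strict | Defeasible | Defeater.

Definition is_strict k := if k is Strict then true else false.
Definition is_sd k := if k is Defeater then false else true.

Definition acyclic (T : eqType) (e : rel T) : Prop :=
  forall c : seq T, cycle e c -> c = [::].

(* Rules are labelled: distinct elements of [rule D] may have the same kind,
   antecedent and consequent.  The finite sets F and A(r) are lists that are
   used only through membership.  [sup D t s] is t > s. *)
Record theory (atom : eqType) := Theory {
  facts : seq (literal atom);
  rule : finType;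
  kind : rule -> rule_kind;
  ante : rule -> seq (literal atom);
  head : rule -> literal atom;
  sup : rel rule;
  sup_acyclic : acyclic sup
}.

Variant tag := Delta | Lambda | Partial | PartialPar.

Definition nat_of_tag t :=
  match t with Delta => 0 | Lambda => 1 | Partial => 2 | PartialPar => 3 end.
Definition tag_of_nat n :=
  match n with 0 => Delta | 1 => Lambda | 2 => Partial | _ => PartialPar end.
Lemma nat_of_tagK : cancel nat_of_tag tag_of_nat. Proof. by case. Qed.
HB.instance Definition _ := Equality.copy tag (can_type nat_of_tagK).

(* The boolean is the sign: true for +, false for -. *)
Notation conclusion atom := (bool * tag * literal atom)%type.

Section Logics.
Variables (atom : eqType) (D : theory atom).

Implicit Types (q : literal atom) (c : conclusion atom).
Implicit Types (r s t : rule D) (P : seq (conclusion atom)).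

Definition Sigma : pred atom := fun p =>
  (p \in [seq l.1 | l <- facts D]) ||
  [exists r : rule D, (p == (head r).1) || (p \in [seq l.1 | l <- ante r])].

Definition Rs q r : bool := is_strict (kind r) && (head r == q).
Definition Rsd q r : bool := is_sd (kind r) && (head r == q).
Definition R q r : bool := head r == q.

Definition all_pos (d : tag) P r : Prop :=
  forall a, a \in ante r -> (true, d, a) \in P.
Definition some_neg (d : tag) P r : Prop :=
  exists2 a, a \in ante r & (false, d, a) \in P.

Inductive is_proof (step : seq (conclusion atom) -> conclusion atom -> Prop) :
    seq (conclusion atom) -> Prop :=
| proof_nil : is_proof step [::]
| proof_append P c : is_proof step P -> step P c -> is_proof step (rcons P c).

Definition derivable (step : seq (conclusion atom) -> conclusion atom -> Prop)
    c : Prop :=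
  exists2 P, is_proof step P & c \in P.

Definition plus_Delta P q : Prop :=
  q \in facts D \/ exists2 r, Rs q r & all_pos Delta P r.

Definition minus_Delta P q : Prop :=
  q \notin facts D /\ forall r, Rs q r -> some_neg Delta P r.

Definition plus_partial P q : Prop :=
  (true, Delta, q) \in P \/
  [/\ exists2 r, Rsd q r & all_pos Partial P r,
      (false, Delta, compl q) \in P
    & forall s, R (compl q) s ->
        some_neg Partial P s \/
        exists t, [/\ Rsd q t, sup t s & all_pos Partial P t]].

Definition minus_partial P q : Prop :=
  (false, Delta, q) \in P /\
  [\/ forall r, Rsd q r -> some_neg Partial P r,
      (true, Delta, compl q) \in P
    | exists s, [/\ R (compl q) s, all_pos Partial P s
        & forall t, Rsd q t -> some_neg Partial P t \/ ~~ sup t s]].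

Variant Delta_step P : conclusion atom -> Prop :=
| Delta_plus q : plus_Delta P q -> Delta_step P (true, Delta, q)
| Delta_minus q : minus_Delta P q -> Delta_step P (false, Delta, q).

Definition P_Delta : conclusion atom -> Prop := derivable Delta_step.

Definition plus_lambda P q : Prop :=
  P_Delta (true, Delta, q) \/
  (exists2 r, Rsd q r & all_pos Lambda P r) /\
  ~ P_Delta (true, Delta, compl q).

Definition minus_lambda P q : Prop :=
  P_Delta (false, Delta, q) /\
  ((forall r, Rsd q r -> some_neg Lambda P r) \/
   P_Delta (true, Delta, compl q)).

Variant lambda_step P : conclusion atom -> Prop :=
| lambda_plus q : plus_lambda P q -> lambda_step P (true, Lambda, q)
| lambda_minus q : minus_lambda P q -> lambda_step P (false, Lambda, q).

Definition P_lambda : conclusion atom -> Prop := derivable lambda_step.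

Definition plus_par P q : Prop :=
  P_Delta (true, Delta, q) \/
  [/\ exists2 r, Rsd q r & all_pos PartialPar P r,
      ~ P_Delta (true, Delta, compl q)
    & forall s, R (compl q) s ->
        (exists2 a, a \in ante s & ~ P_lambda (true, Lambda, a)) \/
        exists t, [/\ Rsd q t, sup t s & all_pos PartialPar P t]].

Definition minus_par P q : Prop :=
  P_Delta (false, Delta, q) /\
  [\/ forall r, Rsd q r -> some_neg PartialPar P r,
      P_Delta (true, Delta, compl q)
    | exists s, [/\ R (compl q) s,
          forall a, a \in ante s -> P_lambda (true, Lambda, a)
        & forall t, Rsd q t -> some_neg PartialPar P t \/ ~~ sup t s]].

Variant DL_partial_step P : conclusion atom -> Prop :=
| DLp_Delta c : Delta_step P c -> DL_partial_step P c
| DLp_plus q : plus_partial P q -> DL_partial_step P (true, Partial, q)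
| DLp_minus q : minus_partial P q -> DL_partial_step P (false, Partial, q).

Variant DL_par_step P : conclusion atom -> Prop :=
| DLpar_Delta c : Delta_step P c -> DL_par_step P c
| DLpar_lambda c : lambda_step P c -> DL_par_step P c
| DLpar_plus q : plus_par P q -> DL_par_step P (true, PartialPar, q)
| DLpar_minus q : minus_par P q -> DL_par_step P (false, PartialPar, q).

End Logics.

Variant logic := DL_partial | DL_par.

Definition main_tag (L : logic) : tag :=
  match L with DL_partial => Partial | DL_par => PartialPar end.

Definition consequence (atom : eqType) (L : logic) (D : theory atom)
    (c : conclusion atom) : Prop :=
  match L with
  | DL_partial => derivable (DL_partial_step D) c
  | DL_par => derivable (DL_par_step D) c
  end.

(* [D1] in [L1] is simulated by [D2] in [L2]. *)
Definition simulated (atom : eqType) (L1 : logic) (D1 : theory atom)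
    (L2 : logic) (D2 : theory atom) : Prop :=
  forall (q : literal atom) (sg : bool), Sigma D1 q.1 ->
    (consequence L1 D1 (sg, Delta, q) <-> consequence L2 D2 (sg, Delta, q)) /\
    (consequence L1 D1 (sg, main_tag L1, q) <->
     consequence L2 D2 (sg, main_tag L2, q)).

(* Main.v *)
Require Import Defs.
From HB Require Import structures.
From mathcomp Require Import all_boot.
From mathcomp Require Import boolp.

Set Implicit Arguments.
Unset Strict Implicit.
Unset Printing Implicit Defensive.

(** In DL(∂), if +∂q holds without +Δq, then an applicable rule for q that is
    maximal for > among the applicable ones is never beaten by a rule for ~q
    that has not failed; hence -∂~q holds as well.  This restricts the joint
    states of q and ~q so much that every combination left can be realised in
    DL(∂||), one proposition at a time and with an empty superiority relation:
    take the provable literals as facts or as heads of rules with empty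
    antecedent, and give every undetermined literal a rule q -> q or q => q.
    On the other hand, DL(∂||) evaluates attacking rules by λ instead of ∂, so
    it can prove q while an attacking rule ~q => ~q, superior to => q, leaves
    ~q undetermined. *)

(** * Proof sequences for an arbitrary step relation *)

Section Proofs.
Variable atom : eqType.
Implicit Types (P Q : seq (conclusion atom)) (c : conclusion atom).
Variable step : seq (conclusion atom) -> conclusion atom -> Prop.

Definition monotone :=
  forall P Q c, {subset P <= Q} -> step P c -> step Q c.

Lemma derivable_invariant (I : conclusion atom -> Prop) :
  (forall P c, is_proof step P -> (forall c', c' \in P -> I c') ->
     step P c -> I c) ->
  forall c, derivable step c -> I c.
Proof.
move=> stepI c [P prP]; elim: prP c => [//|{}P c prP IH stP] c'.
rewrite mem_rcons inE => /predU1P[->|/IH//].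
exact: stepI prP IH stP.
Qed.

Lemma derivable_step P c : is_proof step P -> step P c -> derivable step c.
Proof.
move=> prP stP; exists (rcons P c); first exact: proof_append.
by rewrite mem_rcons mem_head.
Qed.

Lemma derivable_inv c :
  derivable step c -> exists2 P, is_proof step P & step P c.
Proof.
case=> P prP; elim: prP => [//|{}P c' prP IH stP].
by rewrite mem_rcons inE => /predU1P[->|/IH//]; exists P.
Qed.

Hypothesis step_mono : monotone.

(** Lets conclusions from different proofs be used together: by monotonicity the steps of [Q] stay
    legal after [P]. *)
Lemma is_proof_cat P Q : is_proof step P -> is_proof step Q ->
  is_proof step (P ++ Q).
Proof.
move=> prP; elim=> [|{}Q c prQ IH stQ]; first by rewrite cats0.
rewrite -rcons_cat; apply: proof_append IH _.
by apply: step_mono stQ => x xQ; rewrite mem_cat xQ orbT.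
Qed.

Lemma is_proof_mem P c : is_proof step P -> c \in P -> step P c.
Proof.
move=> prP; elim: prP c => [//|{}P c prP IH stP] c'.
have sub : {subset P <= rcons P c}.
  by move=> x xP; rewrite mem_rcons inE xP orbT.
rewrite mem_rcons inE => /predU1P[->|/IH]; first exact: step_mono sub stP.
exact: step_mono.
Qed.

End Proofs.

(** * Coherence and complementary literals in DL(∂) *)

Section Partial.
Variables (atom : eqType) (D : theory atom).
Implicit Types (P Q : seq (conclusion atom)) (q : literal atom).
Implicit Types (r s t : rule D).

Lemma complK : involutive (@compl atom).
Proof. by case=> p b; rewrite /compl negbK. Qed.

Lemma sub_all_pos d P Q r :
  {subset P <= Q} -> all_pos d P r -> all_pos d Q r.
Proof. by move=> sPQ Pr a /Pr/sPQ. Qed.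

Lemma sub_some_neg d P Q r :
  {subset P <= Q} -> some_neg d P r -> some_neg d Q r.
Proof. by move=> sPQ [a ar /sPQ aQ]; exists a. Qed.

Lemma DL_partial_monotone : monotone (DL_partial_step D).
Proof.
move=> P Q c sPQ; have pos := sub_all_pos sPQ; have neg := sub_some_neg sPQ.
case=> {c} [c [q pl|q mi]|q pl|q mi].
- apply: DLp_Delta; apply: Delta_plus.
  case: pl => [|[r rq /pos]]; first by left.
  by right; exists r.
- apply: DLp_Delta; apply: Delta_minus; case: mi => qF mi.
  by split=> // r /mi/neg.
- apply: DLp_plus; case: pl => [/sPQ|[[r rq /pos rP] /sPQ nq att]]; [by left|].
  right; split=> //; first by exists r.
  move=> s /att[/neg|[t [tq ts /pos]]]; first by left.
  by right; exists t.
- apply: DLp_minus; case: mi => /sPQ nq mi; split=> //.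
  case: mi => [H|/sPQ H|[s [sq /pos sP H]]].
  + by apply: Or31 => r /H/neg.
  + exact: Or32.
  + by apply: Or33; exists s; split=> // t /H[/neg|]; [left|right].
Qed.

Lemma DL_partial_stepE P c : DL_partial_step D P c ->
  match c with
  | (true, Delta, q) => plus_Delta D P q
  | (false, Delta, q) => minus_Delta D P q
  | (true, Partial, q) => plus_partial D P q
  | (false, Partial, q) => minus_partial D P q
  | _ => False
  end.
Proof. by case=> // {}c []. Qed.

Definition coherent P :=
  forall d q, (true, d, q) \in P -> (false, d, q) \in P -> False.

Lemma all_pos_some_neg d P r :
  coherent P -> all_pos d P r -> some_neg d P r -> False.
Proof. by move=> coP pos [a /pos]; apply: coP. Qed.

(** The condition for a negative tag is the strong negation of the positive one, so over a coherent
    [P] each way to satisfy one contradicts the other. *)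
Lemma DL_partial_step_clash P d q : coherent P ->
  DL_partial_step D P (true, d, q) -> DL_partial_step D P (false, d, q) ->
  False.
Proof.
move=> coP; have clash r d' := @all_pos_some_neg d' P r coP.
case: d => /DL_partial_stepE plq /DL_partial_stepE miq //.
  case: miq => qF miq; case: plq => [qF'|[r /miq mr /clash]]; last exact.
  by rewrite qF' in qF.
case: miq => nDq miq.
case: plq => [/coP/(_ nDq)//|[[r rq rP] nDcq att]].
case: miq => [/(_ r rq)/(clash _ _ rP)//|/coP/(_ nDcq)//|[s [sq sP beat]]].
case: (att s sq) => [/(clash _ _ sP)//|[t [tq ts tP]]].
by case: (beat t tq) => [/(clash _ _ tP)//|]; rewrite ts.
Qed.

Lemma DL_partial_proof_coherent P :
  is_proof (DL_partial_step D) P -> coherent P.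
Proof.
elim=> [//|{}P c prP IH stP] d q.
(* Earlier conclusions can be derived afresh from the whole of [P], so any clash is examined over
   [P], which is coherent by induction. *)
have all_step c' : c' \in rcons P c -> DL_partial_step D P c'.
  rewrite mem_rcons inE => /predU1P[->//|].
  exact: (is_proof_mem DL_partial_monotone prP).
by move=> /all_step pl /all_step; apply: DL_partial_step_clash pl.
Qed.

Lemma DL_partial_coherent d q :
  consequence DL_partial D (true, d, q) ->
  consequence DL_partial D (false, d, q) -> False.
Proof.
move=> [P prP qP] [Q prQ qQ].
have := DL_partial_proof_coherent (is_proof_cat DL_partial_monotone prP prQ).
by move/(_ d q); rewrite !mem_cat qP qQ orbT; apply.
Qed.

Lemma partial_of_Delta q : consequence DL_partial D (true, Delta, q) ->
  consequence DL_partial D (true, Partial, q).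
Proof.
by case=> P prP qP; apply: derivable_step prP _; apply: DLp_plus; left.
Qed.

Lemma minus_partial_Delta q : consequence DL_partial D (false, Partial, q) ->
  consequence DL_partial D (false, Delta, q).
Proof.
by case/derivable_inv=> P prP /DL_partial_stepE[nDq _]; exists P.
Qed.

Lemma minus_partial_of_Delta_compl q :
  consequence DL_partial D (false, Delta, q) ->
  consequence DL_partial D (true, Delta, compl q) ->
  consequence DL_partial D (false, Partial, q).
Proof.
move=> [P prP qP] [Q prQ qQ].
apply: derivable_step (is_proof_cat DL_partial_monotone prP prQ) _.
apply: DLp_minus; split; first by rewrite mem_cat qP.
by apply: Or32; rewrite mem_cat qQ orbT.
Qed.

(* Stated for [e]-paths of length two because superiority alternates between
   rules for q and rules for ~q and need not be transitive. *)
Lemma acyclic_maximal (T : finType) (e : rel T) (A : pred T) x0 :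
  acyclic e -> A x0 ->
  exists2 m, A m & forall y z, A z -> e z y -> ~~ e y m.
Proof.
(* [below x] counts the elements that reach [x], and [m] minimises it on [A]. Along a path from [z]
   through [y] to [m], fewer elements reach [z] than [m], since [m] reaching [z] would close a
   cycle. *)
move=> acy Ax0; pose below x := #|[set z | connect e z x]|.
have [m Am min] := @arg_minnP T x0 A below Ax0.
exists m => // y z Az zy; apply/negP=> ym.
have := min z Az; rewrite leqNgt => /negP; apply.
have zm : connect e z m by apply: connect_trans (connect1 zy) (connect1 ym).
apply: proper_card; apply/properP; split.
  by apply/subsetP=> w; rewrite !inE => /connect_trans; apply.
exists m; rewrite !inE ?connect0 //; apply/negP=> /connectP[p pth lst].
have /acy// : cycle e (m :: rcons p y).
by rewrite /= !rcons_path pth last_rcons ym -lst zy.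
Qed.

Lemma plus_partial_inv q :
  consequence DL_partial D (true, Partial, q) ->
  ~ consequence DL_partial D (true, Delta, q) ->
  consequence DL_partial D (false, Delta, compl q) /\
  consequence DL_partial D (false, Partial, compl q).
Proof.
case/derivable_inv=> P prP /DL_partial_stepE[qP|[[r rq rP] nDcq att]] nDq.
  by case: nDq; exists P.
split; first by exists P.
pose A := [pred t : rule D |
  Rsd q t & all (fun a => (true, Partial, a) \in P) (ante t)].
have [m /andP[mq /allP mP] mmax] : exists2 m, A m &
    forall y z, A z -> sup z y -> ~~ sup y m.
  apply: acyclic_maximal (@sup_acyclic _ D) _; apply/andP.
  by split; [exact: rq|exact/allP].
apply: derivable_step prP _; apply: DLp_minus; split=> //; apply: Or33.
exists m; split; first by rewrite complK; case/andP: mq.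
  exact: mP.
(* If [t] has not failed, some applicable [u] for [q] beats it; [t] beating [m] would then give a
   path from [u] through [t] to [m], against the choice of [m]. *)
move=> t /andP[_ tq].
case: (att t tq) => [|[u [uq ut /allP uP]]]; [by left|right].
by apply: mmax ut; apply/andP; split.
Qed.

Lemma plus_partial_compl q :
  consequence DL_partial D (true, Partial, q) ->
  ~ consequence DL_partial D (true, Delta, q) ->
  ~ consequence DL_partial D (true, Partial, compl q).
Proof.
move=> pq nDq pcq; have [_] := plus_partial_inv pq nDq.
exact: DL_partial_coherent.
Qed.

Lemma minus_partial_of_compl q :
  consequence DL_partial D (false, Delta, q) ->
  consequence DL_partial D (true, Partial, compl q) ->
  consequence DL_partial D (false, Partial, q).
Proof.
move=> nDq pcq.
have [|nDcq] := EM (consequence DL_partial D (true, Delta, compl q)).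
  exact: minus_partial_of_Delta_compl.
by have [_] := plus_partial_inv pcq nDcq; rewrite complK.
Qed.

End Partial.

(** * Simulation of DL(∂) in DL(∂||) *)

Lemma DL_par_stepE (atom : eqType) (D : theory atom)
    (P : seq (conclusion atom)) (c : conclusion atom) :
  DL_par_step D P c ->
  match c with
  | (true, Delta, q) => plus_Delta D P q
  | (false, Delta, q) => minus_Delta D P q
  | (true, Lambda, q) => plus_lambda D P q
  | (false, Lambda, q) => minus_lambda D P q
  | (true, PartialPar, q) => plus_par D P q
  | (false, PartialPar, q) => minus_par D P q
  | _ => False
  end.
Proof. by case=> // {}c []. Qed.

Lemma acyclic_pred0 (T : finType) : acyclic (fun _ _ : T => false).
Proof. by case=> // x [|y c]. Qed.

Section Simulation.
Variables (atom : eqType) (D : theory atom).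
Implicit Types (P : seq (conclusion atom)) (q : literal atom).

Local Notation prov := (consequence DL_partial D).

(** Facts and rules must be finite in number, while [atom] may be infinite. *)
Definition literals : seq (literal atom) :=
  [seq (p, b) | p <- [seq l.1 | l <- facts D] ++
                     flatten [seq (Defs.head r).1 :: [seq l.1 | l <- ante r]
                             | r <- enum (rule D)],
                b <- [:: true; false]].

Lemma mem_literals q : (q \in literals) = Sigma D q.1.
Proof.
have -> : Sigma D q.1 = (q.1 \in [seq l.1 | l <- facts D] ++
    flatten [seq (Defs.head r).1 :: [seq l.1 | l <- ante r]
            | r <- enum (rule D)]).
  rewrite mem_cat /Sigma; congr (_ || _).
  apply/existsP/flatten_mapP => [[r qr]|[r _ qr]]; exists r => //.
  by rewrite mem_enum.
apply/allpairsP/idP => [[[p b] /= [pL _ ->]]//|qL].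
by exists q; split; [| case: (q.2) | case: (q)].
Qed.

Definition undetermined d q := ~ prov (true, d, q) /\ ~ prov (false, d, q).

(* [(strict, loop, q)] stands for the rule with head [q], strict or defeasible,
   and with antecedent [q] or empty. *)
Definition entries : seq (bool * bool * literal atom) :=
  [seq (true, true, q) | q <- literals & `[< undetermined Delta q >]] ++
  [seq (false, false, q) | q <- literals & `[< prov (true, Partial, q) >]] ++
  [seq (false, true, q) | q <- literals & `[< undetermined Partial q >]].

Definition entry (i : 'I_(size entries)) := tnth (in_tuple entries) i.

Definition sim_theory : theory atom := {|
  facts := [seq q <- literals | `[< prov (true, Delta, q) >]];
  rule := 'I_(size entries);
  kind := fun i => if (entry i).1.1 then Strict else Defeasible;
  ante := fun i => if (entry i).1.2 then [:: (entry i).2] else [::];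
  Defs.head := fun i => (entry i).2;
  sup := fun _ _ => false;
  sup_acyclic := @acyclic_pred0 _ |}.

Local Notation D2 := sim_theory.

Lemma sim_facts q :
  q \in facts D2 <-> q \in literals /\ prov (true, Delta, q).
Proof.
rewrite mem_filter; split=> [/andP[/asboolP]//|[-> qD]].
by rewrite andbT; apply/asboolP.
Qed.

(** Read off a rule by [sim_ruleP] and turned back into a rule by [sim_rule_exists]. The cases may
    overlap for one [q]. *)
Variant sim_rule_spec q : rule_kind -> seq (literal atom) -> Prop :=
| StrictLoop of undetermined Delta q : sim_rule_spec q Strict [:: q]
| EmptyAnte of prov (true, Partial, q) : sim_rule_spec q Defeasible [::]
| DefeasibleLoop of undetermined Partial q :
    sim_rule_spec q Defeasible [:: q].

Lemma sim_ruleP (r : rule D2) : sim_rule_spec (Defs.head r) (kind r) (ante r).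
Proof.
have : entry r \in entries by exact: mem_tnth.
rewrite /entries !mem_cat /= => /or3P[] /mapP[q];
  rewrite mem_filter => /andP[/asboolP qP _] ->; by constructor.
Qed.

Lemma sim_rule_exists q k A : q \in literals -> sim_rule_spec q k A ->
  exists r : rule D2, [/\ Defs.head r = q, kind r = k & ante r = A].
Proof.
move=> qL spec.
have [b [l [eL -> ->]]] : exists b l, [/\ (b, l, q) \in entries,
    k = (if b then Strict else Defeasible) & A = (if l then [:: q] else [::])].
  case: spec => [u|p|u];
    [exists true, true|exists false, false|exists false, true];
    split=> //; rewrite !mem_cat; apply/or3P;
    [apply: Or31|apply: Or32|apply: Or33];
    apply/mapP; exists q => //; rewrite mem_filter qL andbT; exact/asboolP.
have /tnthP[i def] : (b, l, q) \in in_tuple entries by [].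
by exists i; rewrite /= /entry -def.
Qed.

(** * Δ conclusions of [sim_theory], treated at once for [P_Delta] and for full DL(∂||) proofs *)

Section Delta.
Variable step : seq (conclusion atom) -> conclusion atom -> Prop.
Hypothesis Delta_sub : forall P c, Delta_step D2 P c -> step P c.
Hypothesis step_Delta : forall P sg q,
  step P (sg, Delta, q) -> Delta_step D2 P (sg, Delta, q).

(** One step suffices: a provable literal is a fact, and a refuted one heads no strict rule. *)
Lemma sim_Delta_complete sg q : q \in literals ->
  prov (sg, Delta, q) -> derivable step (sg, Delta, q).
Proof.
move=> qL qD; apply: derivable_step (proof_nil step) _; apply: Delta_sub.
case: sg qD => qD; constructor; first by left; apply/sim_facts.
split; first by apply/negP => /sim_facts[_] /DL_partial_coherent; apply.
by move=> r /andP[+ /eqP rq]; case: sim_ruleP; rewrite // rq => -[].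
Qed.

(** A strict loop on [q] lets neither sign of [q] through unless it already occurs earlier in the
    proof. Only the negative case needs [q] in [literals], to obtain the loop. *)
Lemma sim_Delta_sound sg q : sg || (q \in literals) ->
  derivable step (sg, Delta, q) -> prov (sg, Delta, q).
Proof.
move=> + dq; pose I (c : conclusion atom) := c.1.2 = Delta ->
  c.1.1 || (c.2 \in literals) -> prov c.
suff IP : forall c, derivable step c -> I c by exact: (IP _ dq).
apply: derivable_invariant => P [[{dq}b d] {}q] _ IH st dD /= qL.
move: st; rewrite (dD : d = Delta) => /step_Delta st.
inversion st as [q' pl|q' mi]; subst.
  case: pl => [/sim_facts[]//|[r /andP[rk /eqP rq] pos]].
  move: rk pos; rewrite /all_pos; case: sim_ruleP => // _ _.
  by rewrite rq => /(_ _ (mem_head _ _)) /IH; apply.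
case: mi => qF mi; have [//|nq] := EM (prov (false, Delta, q)).
have und : undetermined Delta q.
  by split=> // pq; case/negP: qF; apply/sim_facts.
have [r [rq rk ra]] := sim_rule_exists qL (StrictLoop und).
case: (mi r); first by rewrite /Rs rk rq /=.
by move=> a; rewrite ra inE => /eqP-> /IH; apply.
Qed.

End Delta.

Lemma sim_P_Delta_complete sg q : q \in literals ->
  prov (sg, Delta, q) -> P_Delta D2 (sg, Delta, q).
Proof. by move=> qL; apply: sim_Delta_complete. Qed.

Lemma sim_P_Delta_sound sg q : sg || (q \in literals) ->
  P_Delta D2 (sg, Delta, q) -> prov (sg, Delta, q).
Proof. by move=> qL; apply: sim_Delta_sound. Qed.

(** The head is either provable in [D] by construction or the antecedent itself. This serves for λ
    and ∂|| alike. *)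
Lemma sim_rule_partial (r : rule D2) :
  (forall a, a \in ante r -> prov (true, Partial, a)) ->
  prov (true, Partial, Defs.head r).
Proof. by case: sim_ruleP => // _; apply; rewrite mem_head. Qed.

Lemma sim_lambda_sound q :
  P_lambda D2 (true, Lambda, q) -> prov (true, Partial, q).
Proof.
move=> dq; pose I c := c.1 = (true, Lambda) -> prov (true, Partial, c.2).
suff IP c : P_lambda D2 c -> I c by exact: IP dq _.
apply: derivable_invariant => P {}c _ IH st; case: st => {dq}q // pl _ /=.
case: pl => [/sim_P_Delta_sound|[[r /andP[_ /eqP<-] pos] _]].
  by move=> /(_ isT)/partial_of_Delta.
by apply: sim_rule_partial => a /pos/IH; apply.
Qed.

(** Although λ ignores attacks, in [sim_theory] it proves nothing beyond +∂ of [D], so an effective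
    attacker reveals a genuine conclusion of [D]. *)
Lemma sim_attack q (s : rule D2) : R (compl q) s ->
  (forall a, a \in ante s -> P_lambda D2 (true, Lambda, a)) ->
  prov (true, Partial, compl q).
Proof.
by move=> /eqP<- pos; apply: sim_rule_partial => a /pos/sim_lambda_sound.
Qed.

Lemma sim_par_complete sg q : q \in literals ->
  prov (sg, Partial, q) -> derivable (DL_par_step D2) (sg, PartialPar, q).
Proof.
move=> qL pq; apply: derivable_step (proof_nil _) _; case: sg pq => pq.
  apply: DLpar_plus; have [qD|nDq] := EM (prov (true, Delta, q)).
    by left; apply: sim_P_Delta_complete.
  have [r [rq rk ra]] := sim_rule_exists qL (EmptyAnte pq).
  right; split.
  - by exists r; [rewrite /Rsd rk rq /=|move=> a; rewrite ra].
  - move=> /sim_P_Delta_sound-/(_ isT) Dcq.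
    by case: (plus_partial_inv pq nDq) => /(DL_partial_coherent Dcq).
  (* An effective attack would yield +∂~q in [D], impossible beside +∂q without +Δq. *)
  - move=> s sq; left; apply: contrapT => noneg.
    apply: (plus_partial_compl pq nDq); apply: sim_attack sq _ => a aA.
    by apply: contrapT => na; apply: noneg; exists a.
have nDq := minus_partial_Delta pq.
apply: DLpar_minus; split; first exact: sim_P_Delta_complete.
(* Vacuous: a literal with -∂q, hence also -Δq, heads no rule of [sim_theory]. *)
apply: Or31 => r /andP[_ /eqP]; case: (sim_ruleP r) => [u|p|u] rq; exfalso.
- by case: u => _; rewrite rq.
- by move: p; rewrite rq => /DL_partial_coherent; apply.
- by case: u => _; rewrite rq.
Qed.

(** For the negative sign, failure of all rules for [q] rules out an empty antecedent, and a loop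
    would need the same conclusion earlier; the other two clauses give +Δ~q or +∂~q in [D], and each
    yields -∂q. *)
Lemma sim_par_sound sg q : sg || (q \in literals) ->
  derivable (DL_par_step D2) (sg, PartialPar, q) -> prov (sg, Partial, q).
Proof.
move=> + dq; pose I (c : conclusion atom) := c.1.2 = PartialPar ->
  c.1.1 || (c.2 \in literals) -> prov (c.1.1, Partial, c.2).
suff IP c : derivable (DL_par_step D2) c -> I c by exact: (IP _ dq).
apply: derivable_invariant => P [[{dq}b d] {}q] _ IH st dD /= qL.
move: st qL; rewrite (dD : d = PartialPar) => /DL_par_stepE.
case: b {dD} => /= st qL.
  case: st => [/sim_P_Delta_sound|[[r /andP[_ /eqP<-] pos] _ _]].
    by move=> /(_ isT)/partial_of_Delta.
  by apply: sim_rule_partial => a /pos/IH; apply.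
case: st => /sim_P_Delta_sound-/(_ qL) nDq.
case=> [neg|/sim_P_Delta_sound-/(_ isT)|[s [/sim_attack att /att pcq _]]].
- have [pq|npq] := EM (prov (true, Partial, q)).
    have [r [rq rk ra]] := sim_rule_exists qL (EmptyAnte pq).
    case: (neg r); first by rewrite /Rsd rk rq /=.
    by move=> a; rewrite ra.
  have [//|nnq] := EM (prov (false, Partial, q)).
  have [r [rq rk ra]] := sim_rule_exists qL (DefeasibleLoop (conj npq nnq)).
  case: (neg r); first by rewrite /Rsd rk rq /=.
  by move=> a; rewrite ra inE => /eqP-> /IH; apply.
- exact: minus_partial_of_Delta_compl.
- exact: minus_partial_of_compl.
Qed.

Lemma sim_theory_simulates : simulated DL_partial D DL_par D2.
Proof.
move=> q sg; rewrite -mem_literals => qL.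
have qL' : sg || (q \in literals) by rewrite qL orbT.
split; split; last exact: sim_par_sound.
- by apply: sim_Delta_complete => // P c; apply: DLpar_Delta.
- by apply: sim_Delta_sound => // P [] l /DL_par_stepE; constructor.
- exact: sim_par_complete.
Qed.

End Simulation.

(** * A theory in DL(∂||) that DL(∂) cannot simulate *)

Section Separation.
Variables (atom : eqType) (p : atom).

Local Notation q := (p, true).
Local Notation nq := (p, false).

Lemma acyclic_sep : acyclic (fun t s : bool => ~~ t && s).
Proof.
by case=> // x [|y c] /=; [case: x|case: x y => [] [] //=; case: c => [|[] c]].
Qed.

(* Rule [true] is => q and rule [false] is ~q => ~q, the latter superior. *)
Definition sep_theory : theory atom := {|
  facts := [::];
  rule := bool;
  kind := fun _ => Defeasible;
  ante := fun b => if b then [::] else [:: nq];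
  Defs.head := fun b => (p, b);
  sup := fun t s => ~~ t && s;
  sup_acyclic := acyclic_sep |}.

Lemma sep_plus_Delta l : ~ P_Delta sep_theory (true, Delta, l).
Proof.
by case/derivable_inv=> P _ st; inversion st as [? [|[]]|].
Qed.

Lemma sep_lambda : ~ P_lambda sep_theory (true, Lambda, nq).
Proof.
move=> dq; pose I c := c <> (true, Lambda, nq).
suff /(_ _ dq) : forall c, P_lambda sep_theory c -> I c by exact.
apply: derivable_invariant => P c _ IH st; case: st => {}l // pl [lq].
case: pl => [/sep_plus_Delta//|[[[] /andP[_ /eqP]]]]; rewrite lq //= => _ pos.
by case: (IH _ (pos _ (mem_head _ _))).
Qed.

Lemma sep_plus_par :
  consequence DL_par sep_theory (true, PartialPar, q).
Proof.
apply: derivable_step (proof_nil _) _; apply: DLpar_plus; right; split.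
- by exists true; rewrite // /Rsd /= eqxx.
- exact: sep_plus_Delta.
- case=> /eqP // _; left; exists nq; first by rewrite mem_head.
  exact: sep_lambda.
Qed.

(** The only rule for ~q can fail only after -∂||~q itself, and while it has not failed it overrides
    the attack by [=> q]. *)
Lemma sep_minus_par :
  ~ consequence DL_par sep_theory (false, PartialPar, nq).
Proof.
move=> dq; pose I c := c <> (false, PartialPar, nq).
suff /(_ _ dq) : forall c, derivable (DL_par_step sep_theory) c -> I c by exact.
apply: derivable_invariant => P c _ IH /DL_par_stepE st cE.
have neg : ~ some_neg PartialPar P (false : rule sep_theory).
  by case=> a; rewrite inE => /eqP-> /IH; apply.
have nqF : Rsd (D := sep_theory) nq false by rewrite /Rsd /= eqxx.
move: st; rewrite cE /= => -[_ [/(_ _ nqF)//|/sep_plus_Delta//|]].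
by move=> [[] [/eqP // _ _ /(_ _ nqF)[]]].
Qed.

Lemma sep_theory_not_simulated (D' : theory atom) :
  ~ simulated DL_par sep_theory DL_partial D'.
Proof.
have sig : Sigma sep_theory p.
  by apply/orP; right; apply/existsP; exists true; rewrite eqxx.
move=> sim; apply: sep_minus_par.
have [_ [_]] := sim nq false sig; apply.
have [_ [/(_ sep_plus_par) pq _]] := sim q true sig.
apply: (proj2 (plus_partial_inv pq _)).
(* [plus_partial_inv] needs that [D'] lacks +Δq; by simulation this comes from [sep_theory], which
   has neither facts nor strict rules. *)
have [[_ +] _] := sim q true sig => /[apply] /derivable_inv[P _].
by case/DL_par_stepE=> // -[[]].
Qed.

End Separation.

Theorem theorem3 (atom : eqType) (p0 : atom) :
  (forall D1 : theory atom,
     exists D2 : theory atom, simulated DL_partial D1 DL_par D2) /\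
  (exists D : theory atom,
     forall D' : theory atom, ~ simulated DL_par D DL_partial D').
Proof.
split=> [D1|].
  by exists (sim_theory D1); apply: sim_theory_simulates.
by exists (sep_theory p0) => D'; apply: sep_theory_not_simulated.
Qed.
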